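(* Let $A\leq B$ (entrywise) be irreducible nonnegative matrices indexed by a countable set $S$ and assume that $B\neq A$ and $\rho(B)<\infty$. Then: (a) If $A$ is R-transient and $\{(x,y)\in S^2:A(x,y)\neq B(x,y)\}$ is finite, then $\rho\big(A+\varepsilon(B-A)\big)=\rho(A)$ for some $\varepsilon>0$. (b) If $\rho(B)=\rho(A)$, then $A$ is R-transient.
   Context: A nonnegative matrix $A=(A(x,y))_{x,y\in S}$ (entries in $[0,\infty)$) indexed by a countable (finite or infinite) set $S$ is irreducible if for each $x,y\in S$ there is an $n\geq 1$ such that $A^n(x,y)>0$. For irreducible $A$, the spectral radius is $\rho(A):=\lim_{n\to\infty}(A^n(x,x))^{1/n}\in(0,\infty]$, where, if $A$ is periodic, $n$ ranges only through those integers for which $A^n(x,x)>0$; the limit exists and does not depend on $x\in S$. An irreducible nonnegative matrix $A$ is R-recurrent if $\rho(A)<\infty$ and $\sum_{n=1}^\infty\rho(A)^{-n}A^n(x,x)=\infty$ for some (equivalently all) $x\in S$. It is R-transient if it is not R-recurrent. *)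

(* Defs.v *)
From HB Require Import structures.
From mathcomp Require Import all_boot all_order all_algebra.
From mathcomp Require Import all_classical all_reals all_analysis.

Set Implicit Arguments.
Unset Strict Implicit.
Unset Printing Implicit Defensive.

Import Order.TTheory GRing.Theory Num.Theory.

Local Open Scope classical_set_scope.
Local Open Scope ring_scope.

Definition nonneg_matrix (R : realType) (S : countType) (A : S -> S -> R) : Prop :=
  forall x y, 0 <= A x y.

(* Entries of powers are infinite sums of nonnegative terms, hence they live in
   [0, +oo]; the convention 0 * +oo = 0 is that of \bar R. *)
Fixpoint mpow (R : realType) (S : countType) (A : S -> S -> R) (n : nat)
    (x y : S) : \bar R :=
  match n with
  | 0%N => (x == y)%:R%:E
  | m.+1 => (\esum_(z in [set: S]) ((A x z)%:E * mpow A m z y))%E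
  end.

Definition irreducible_matrix (R : realType) (S : countType)
    (A : S -> S -> R) : Prop :=
  forall x y, exists2 n : nat, (1 <= n)%N & (0 < mpow A n x y)%E.

(* The limit is taken along those n with A^n(x,x) > 0, which for irreducible A
   form an infinite set. *)
Definition is_spectral_radius (R : realType) (S : countType)
    (A : S -> S -> R) (r : \bar R) : Prop :=
  forall x, (fun n : nat => (mpow A n x x `^ (n%:R^-1))%E)
              @ within [set n : nat | (0 < mpow A n x x)%E] \oo --> r.

(* For irreducible nonnegative A on a nonempty S there is exactly one r with
   is_spectral_radius A r; otherwise the value need not be meaningful. *)
Definition spectral_radius (R : realType) (S : countType)
    (A : S -> S -> R) : \bar R :=
  get [set r : \bar R | is_spectral_radius A r].

Definition R_recurrent (R : realType) (S : countType) (A : S -> S -> R) : Prop :=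
  (spectral_radius A < +oo)%E /\
  exists x, (\sum_(1 <= n <oo)
    (((fine (spectral_radius A)) ^- n)%:E * mpow A n x x))%E = +oo%E.

(* Only meant for irreducible nonnegative matrices. *)
Definition R_transient (R : realType) (S : countType) (A : S -> S -> R) : Prop :=
  ~ R_recurrent A.

(* Main.v *)
Require Import Defs.
From HB Require Import structures.
From mathcomp Require Import all_boot all_order all_algebra.
From mathcomp Require Import all_classical all_reals all_analysis.
From mathcomp Require Import ring lra zify.

Set Implicit Arguments.
Unset Strict Implicit.
Unset Printing Implicit Defensive.

Import Order.TTheory GRing.Theory Num.Theory.

Local Open Scope classical_set_scope.
Local Open Scope ring_scope.

(** Everything rests on one description of the spectral radius: [rho(A)] is the
    least [r] with [A^n(x,x) <= r^n] for all [n >= 1], whatever the point [x]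
    ([spectral_radius_leP]). Indeed [A^n(x,x)] is supermultiplicative in [n], so
    by Fekete's argument its [n]-th roots converge, along the [n] where it is
    positive, to their supremum. In particular [rho] is monotone in the matrix.

    Write [r = rho(A)] and [G(x,y) = \sum_n r^-n A^n(x,y)]. Irreducibility makes the
    entries of [G] all finite or all infinite ([green_pinfty_transfer]), so [A] is
    R-transient exactly when [G] is finite.

    (a) Put [D = B - A] and let [P] be the finite set of nonzero rows of [D]. If [G] is
    finite, then [h = \sum_(p in P) G(.,p)] is finite and satisfies
    [A h = r h - r 1_P]. As [D h] is finite and vanishes outside [P], a small
    [eps] gives [eps D h <= r 1_P], hence [(A + eps D) h <= r h]. Iterating,
    [(A + eps D)^n(x,x) h(x) <= r^n h(x)], which bounds the spectral radius of
    [A + eps D] by [r] because [h(x) > 0] for [x] in [P]; see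
    [supersolution_mpow_le] and [finite_perturbation_mpow_le].

    (b) Let [d = B(x0,y0) - A(x0,y0)] be positive and suppose [rho(B) = r], so that
    [v_m = r^-m B^m(y0,y0)] is at most [1]. Cutting paths at the first use of the
    increment [d] gives [v_m >= \sum_(j < m) w_j v_(m-1-j)] with
    [w_j = d r^-(j+1) A^j(y0,x0)] ([mpow_first_use_ge]). If the [w_j] summed to more
    than [1], the partial sums of [v] would grow too fast for a sequence bounded
    by [1] ([renewal_sum_le1]). Hence [G(y0,x0) <= r / d] is finite, and [A] cannot
    be R-recurrent. *)

(** * Sums of nonnegative extended reals *)

Section NonnegativeSums.
Context {R : realType}.
Local Open Scope ereal_scope.

Lemma ge0_esumZl (T : choiceType) (x : \bar R) (a : T -> \bar R) :
  0 <= x -> (forall i, 0 <= a i) ->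
  \esum_(i in [set: T]) (x * a i) = x * \esum_(i in [set: T]) a i.
Proof.
move=> x0 a0; apply/eqP; rewrite eq_le; apply/andP; split.
  apply: ge_ereal_sup => _ [F finF <-].
  rewrite -ge0_mule_fsumr//; apply: lee_wpmul2l => //.
  by apply: ereal_sup_ubound; exists F.
have [->|aN0] := eqVneq (\esum_(i in [set: T]) a i) 0.
  by rewrite mule0; apply: esum_ge0 => i _; exact: mule_ge0.
case: x x0 => [x x0| _ |//].
  have [->|xN0] := eqVneq x 0%R.
    by rewrite mul0e; apply: esum_ge0 => i _; rewrite mul0e.
  have {xN0 x0} x0 : (0 < x)%R by rewrite lt0r xN0 -lee_fin.
  rewrite -lee_pdivlMl//; apply: ge_ereal_sup => _ [F finF <-].
  rewrite lee_pdivlMl// ge0_mule_fsumr//.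
  by apply: ereal_sup_ubound; exists F.
have [i ai0] : exists i, 0 < a i.
  apply/not_existsP => ai; case/eqP: aN0; apply: esum1 => i _.
  by apply/eqP; rewrite eq_le a0 andbT leNgt; exact/negP.
apply: (@le_trans _ _ +oo); first by rewrite leey.
apply: esum_ge; exists [set i]; first by split => //; exact: finite_set1.
by rewrite fsbig_set1 gt0_mulye.
Qed.

Lemma ge0_esumZr (T : choiceType) (x : \bar R) (a : T -> \bar R) :
  0 <= x -> (forall i, 0 <= a i) ->
  \esum_(i in [set: T]) (a i * x) = (\esum_(i in [set: T]) a i) * x.
Proof.
move=> x0 a0; rewrite muleC -ge0_esumZl//.
by apply: eq_esum => i _; rewrite muleC.
Qed.

Lemma esum_ge_term (T : choiceType) (a : T -> \bar R) i :
  a i <= \esum_(j in [set: T]) a j.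
Proof.
apply: esum_ge; exists [set i]; first by split => //; exact: finite_set1.
by rewrite fsbig_set1.
Qed.

(** Finite sums commute with series; the inequality passes to the supremum over
    finite sets that defines the left-hand side. *)
Lemma esum_nneseries_le (T : choiceType) (f : T -> nat -> \bar R) :
  (forall t n, 0 <= f t n) ->
  \esum_(t in [set: T]) \sum_(n <oo) f t n <=
  \sum_(n <oo) \esum_(t in [set: T]) f t n.
Proof.
move=> f0; apply: ge_ereal_sup => _ [F [finF FT] <-].
rewrite fsbig_finite//= -nneseries_sum//; apply: lee_nneseries => [n _ _|n _].
  by apply: sume_ge0 => t _.
by apply: esum_ge; exists F => //; rewrite fsbig_finite.
Qed.

Lemma nneseries_ge_term (a : nat -> \bar R) k : (forall n, 0 <= a n) ->
  a k <= \sum_(n <oo) a n.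
Proof.
move=> a0; apply: le_trans (nneseries_lim_ge k.+1 _) => //.
by rewrite big_nat_recr//= leeDr// sume_ge0.
Qed.

Lemma gt0_real_lower_bound (x : \bar R) :
  0 < x -> exists2 e : R, (0 < e)%R & e%:E <= x.
Proof.
case: x => [e|_|//]; first by exists e.
by exists 1%R => //; rewrite leey.
Qed.

End NonnegativeSums.

(** * Powers of nonnegative matrices *)

Section MatrixPowers.
Context {R : realType} {S : countType}.
Implicit Types A B : S -> S -> R.
Local Open Scope ereal_scope.

Lemma mpow_ge0 A n x y : nonneg_matrix A -> 0 <= mpow A n x y.
Proof.
move=> A0; elim: n x => [|n IH] x /=; first by rewrite lee_fin ler0n.
by apply: esum_ge0 => z _; apply: mule_ge0 => //; rewrite lee_fin.
Qed.

(** Paths through [z] at time [m] are some of the paths of length [m + n]. *)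
Lemma mpowD_ge A m n x y z : nonneg_matrix A ->
  mpow A m x z * mpow A n z y <= mpow A (m + n) x y.
Proof.
move=> A0; elim: m x => [|m IH] x.
  rewrite add0n /=; have [->|_] := eqVneq x z; first by rewrite mul1e.
  by rewrite mul0e mpow_ge0.
rewrite addSn /= -ge0_esumZr ?mpow_ge0//; last first.
  by move=> w; rewrite mule_ge0 ?lee_fin ?mpow_ge0.
apply: le_esum => w _; rewrite -muleA lee_wpmul2l ?lee_fin//.
Qed.

Lemma le_mpow A B n x y : nonneg_matrix A -> (forall x y, (A x y <= B x y)%R) ->
  mpow A n x y <= mpow B n x y.
Proof.
move=> A0 AB; elim: n x => [//|n IH] x /=.
by apply: le_esum => z _; rewrite lee_pmul ?lee_fin ?mpow_ge0.
Qed.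

Lemma le_irreducible A B : nonneg_matrix A -> (forall x y, (A x y <= B x y)%R) ->
  irreducible_matrix A -> irreducible_matrix B.
Proof.
move=> A0 AB Ai x y; have [n n1 An] := Ai x y; exists n => //.
exact: lt_le_trans (le_mpow n x y A0 AB).
Qed.

(** Any function [h] with [A h <= r h] controls the diagonal of all powers: this
    is how a single application of the matrix yields an upper bound on its
    spectral radius. *)
Lemma supersolution_mpow_le A (r : R) (h : S -> \bar R) :
  nonneg_matrix A -> (0 <= r)%R -> (forall x, 0 <= h x) ->
  (forall x, \esum_(z in [set: S]) ((A x z)%:E * h z) <= r%:E * h x) ->
  forall n x y, mpow A n x y * h y <= (r ^+ n)%:E * h x.
Proof.
move=> A0 r0 h0 Ah; elim=> [|n IH] x y /=.
  rewrite expr0 mul1e; have [->|_] := eqVneq x y; first by rewrite mul1e.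
  by rewrite mul0e h0.
rewrite -ge0_esumZr//; last by move=> w; rewrite mule_ge0 ?lee_fin ?mpow_ge0.
apply: (@le_trans _ _
    (\esum_(z in [set: S]) ((r ^+ n)%:E * ((A x z)%:E * h z)))).
  apply: le_esum => z _; rewrite -muleA muleCA.
  by rewrite [leRHS]muleCA [leLHS]muleCA lee_wpmul2l ?lee_fin.
rewrite ge0_esumZl ?lee_fin ?exprn_ge0//; last first.
  by move=> z; rewrite mule_ge0 ?lee_fin.
by rewrite exprSr EFinM -muleA lee_wpmul2l ?lee_fin ?exprn_ge0.
Qed.

End MatrixPowers.

(** * Roots of supermultiplicative sequences *)

Section RootGrowth.
Context {R : realType}.

Lemma geometric_domination (u t eta K : R) : 0 <= u -> u < t -> 0 < eta ->
  \forall q \near \oo, K * u ^+ q < eta * t ^+ q.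
Proof.
move=> u0 ut eta0; have t0 : 0 < t by exact: le_lt_trans ut.
have zt : `|u / t| < 1.
  by rewrite ger0_norm ?divr_ge0 ?(ltW t0)// ltr_pdivrMr// mul1r.
have /cvgr_dist_lt/(_ _ eta0) := cvg_geometric K zt.
apply: filterS => q; rewrite sub0r normrN /geometric/= => /ltr_normlW.
by rewrite expr_div_n mulrA ltr_pdivrMr ?exprn_gt0.
Qed.

Variable a : nat -> \bar R.
Hypothesis a_ge0 : forall n, (0 <= a n)%E.
Hypothesis a_supermul : forall m n, (a m * a n <= a (m + n))%E.

Lemma supermul_expr_le (t : R) m q : (0 < m)%N -> 0 <= t -> (t%:E <= a m)%E ->
  (0 < q)%N -> ((t ^+ q)%:E <= a (q * m)%N)%E.
Proof.
move=> m0 t0 tam; elim: q => // -[_ _|q IH _]; first by rewrite expr1 mul1n.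
rewrite exprS EFinM mulSn; apply: le_trans (a_supermul _ _).
by rewrite lee_pmul ?lee_fin ?exprn_ge0// IH.
Qed.

Lemma exists_real_between (c : R) (x : \bar R) : (c%:E < x)%E ->
  exists2 t : R, c < t & (t%:E <= x)%E.
Proof.
case: x => [t|_|//]; first by exists t.
by exists (c + 1); rewrite ?leey// ltrDl.
Qed.

(** A supermultiplicative sequence that beats [c ^+ m] once beats [c ^+ n] at
    every large [n] of its support: writing [n = n0 + q * m], with [n0] a
    point of the support in the residue class of [n] modulo [m], one has
    [a n >= a n0 * (a m) ^+ q], and the geometric factor wins for large [q]. The
    thresholds are uniform because there are only [m] classes; classes that miss
    the support impose nothing, which takes care of periodicity. *)
Lemma supermul_growth (c : R) m : (0 < m)%N -> 0 <= c -> ((c ^+ m)%:E < a m)%E ->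
  \forall n \near \oo, (0 < a n)%E -> ((c ^+ n)%:E < a n)%E.
Proof.
move=> m0 c0 /exists_real_between[t ct tam].
have t0 : 0 < t by apply: le_lt_trans ct; rewrite exprn_ge0.
have class r : exists N, forall n, (N <= n)%N -> n = r %[mod m] ->
    (0 < a n)%E -> ((c ^+ n)%:E < a n)%E.
  have [[n0 [n0r an0]]|nex] :=
      pselect (exists n0, n0 = r %[mod m] /\ (0 < a n0)%E); last first.
    by exists 0%N => n _ nr an; case: nex; exists n.
  have [eta eta0 etaa] := gt0_real_lower_bound an0.
  have [Q _ HQ] :=
    geometric_domination (c ^+ n0) (exprn_ge0 m c0) ct eta0.
  exists (n0 + Q.+1 * m)%N => n Nn nr an.
  have n0n : (n0 <= n)%N by apply: leq_trans Nn; rewrite leq_addr.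
  have : (m %| n - n0)%N by rewrite -eqn_mod_dvd// n0r nr.
  move=> /dvdnP[q nq]; have En : n = (n0 + q * m)%N by rewrite -nq subnKC.
  have Qq : (Q < q)%N by move: Nn; rewrite En leq_add2l leq_pmul2r.
  rewrite En; apply: lt_le_trans (a_supermul _ _).
  apply: (@lt_le_trans _ _ (eta%:E * (t ^+ q)%:E)%E).
    rewrite -EFinM lte_fin exprD mulnC exprM.
    by apply: HQ; rewrite /= ltnW.
  rewrite lee_pmul// ?lee_fin ?exprn_ge0// ?(ltW eta0) ?(ltW t0)//.
  by rewrite supermul_expr_le ?(ltW t0)// (leq_trans _ Qq).
have [N HN] := choice class.
exists (\max_(r < m) N r)%N => // n /= Nn an.
apply: (HN (n %% m)%N) => //; last by rewrite modn_mod.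
apply: leq_trans Nn.
by rewrite (leq_bigmax (F := fun r : 'I_m => N r) (Ordinal (ltn_pmod n m0))).
Qed.

Definition root_sup : \bar R :=
  ereal_sup [set (a n `^ (n%:R^-1))%E | n in [set n | (0 < n)%N]].

Lemma root_le (x : \bar R) (c : R) n : (0 <= x)%E -> 0 <= c -> (0 < n)%N ->
  (x `^ (n%:R^-1) <= c%:E)%E = (x <= (c ^+ n)%:E)%E.
Proof.
case: x => [x| |] // x0 c0 n0; last first.
  by rewrite poweRyr// invr_neq0// pnatr_eq0 -lt0n.
have nN0 : n%:R != 0 :> R by rewrite pnatr_eq0 -lt0n.
rewrite poweR_EFin !lee_fin; rewrite lee_fin in x0.
have {2}-> : x = (x `^ n%:R^-1) ^+ n.
  by rewrite -powR_mulrn ?powR_ge0// -powRrM mulVf// powRr1.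
by rewrite ler_pXn2r// ?nnegrE ?powR_ge0.
Qed.

Lemma root_sup_ge0 : (0 <= root_sup)%E.
Proof.
apply: (@le_trans _ _ (a 1 `^ (1%:R^-1))%E); first exact: poweR_ge0.
by apply: ereal_sup_ubound; exists 1%N.
Qed.

Lemma root_sup_leP (c : R) : 0 <= c ->
  (root_sup <= c%:E)%E <-> forall n, (0 < n)%N -> (a n <= (c ^+ n)%:E)%E.
Proof.
move=> c0; split=> [ac n n0|ac].
  rewrite -root_le//; apply: le_trans ac.
  by apply: ereal_sup_ubound; exists n.
by apply: ge_ereal_sup => _ [n n0 <-]; rewrite root_le// ac.
Qed.

(** Fekete's lemma along the support of the sequence: the terms never exceed the
    supremum, and [supermul_growth] keeps them above any smaller bound. *)
Lemma cvg_root_sup :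
  (a n `^ (n%:R^-1))%E @[n --> within [set n | (0 < a n)%E] \oo] --> root_sup.
Proof.
have upper n : (0 < n)%N -> (a n `^ (n%:R^-1) <= root_sup)%E.
  by move=> n0; apply: ereal_sup_ubound; exists n.
move=> U; rewrite itv_nbhsE => -[i [iopen iL] iU].
case: i iopen iL iU => l u iopen; rewrite inE/= => /andP[lL Lu] iU.
rewrite nbhs_simpl/=.
suff : \forall n \near \oo, (0 < a n)%E ->
    (l <= BLeft (a n `^ (n%:R^-1))%E)%O.
  move=> near_l.
  have n1 : \forall n \near \oo, (0 < n)%N by exact: nbhs_infty_gt.
  rewrite /nbhs/= /within/=; near=> n => an.
  apply: iU; rewrite /= itv_boundlr; apply/andP; split; last first.
    apply: le_trans Lu; rewrite bnd_simp; apply: upper.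
    by near: n.
  by move: an; near: n.
case: l lL iopen {iU} => [b l|b] lL; last first.
  by move=> /itv_open_ends_linfty ->; apply: nearW.
move=> /itv_open_ends_lside Eb; move: lL; rewrite Eb bnd_simp => lL.
case: l lL => [l| |] lL; last 2 first.
- by move: lL; rewrite ltNge leey.
- near=> n => _; rewrite bnd_simp; apply: lt_le_trans (poweR_ge0 _ _).
  exact: ltNyr.
have [l0|l0] := ltP l 0.
  near=> n => _; rewrite bnd_simp; apply: lt_le_trans (poweR_ge0 _ _).
  by rewrite lte_fin.
have [_ [m m0 <-]] := ereal_sup_gt lL.
rewrite ltNge root_le// -ltNge => /(supermul_growth m0 l0) near_growth.
have n1 : \forall n \near \oo, (0 < n)%N by exact: nbhs_infty_gt.
near=> n => an; rewrite bnd_simp ltNge root_le// -?ltNge; last by near: n.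
by move: an; near: n.
Unshelve. all: by end_near. Qed.

End RootGrowth.

(** * The spectral radius *)

Section SpectralRadius.
Context {R : realType} {S : countType}.
Variable A : S -> S -> R.
Hypotheses (A_ge0 : nonneg_matrix A) (A_irr : irreducible_matrix A).

Let diag x n := mpow A n x x.
Let diag_ge0 x n : (0 <= diag x n)%E.
Proof. exact: mpow_ge0. Qed.
Let diag_supermul x m n : (diag x m * diag x n <= diag x (m + n))%E.
Proof. exact: mpowD_ge. Qed.

(** The support contains all positive multiples of a return time; limits along it
    are therefore unique. *)
Lemma within_support_proper x :
  ProperFilter (within [set n | (0 < mpow A n x x)%E] \oo).
Proof.
apply: Build_ProperFilter_ex => P [N _ HN].
have [m m0 am] := A_irr x x.
have [t t0 tam] := gt0_real_lower_bound am.
have Am_ge := supermul_expr_le (@diag_supermul x) m0 (ltW t0) tam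
  (ltn0Sn N).
exists (N.+1 * m)%N; apply: HN.
  by rewrite /= (leq_trans (leqnSn N))// leq_pmulr.
by apply: lt_le_trans Am_ge; rewrite lte_fin exprn_gt0.
Qed.

(** A path from [x] to [y] and back turns [(A^m(x,x))^q] into a lower bound for a
    diagonal entry at [y], at the cost of a constant factor, which the root
    [1/n] kills. *)
Lemma diag_bound_transfer (r : R) x y : 0 <= r ->
  (forall n, (0 < n)%N -> (mpow A n y y <= (r ^+ n)%:E)%E) ->
  forall n, (0 < n)%N -> (mpow A n x x <= (r ^+ n)%:E)%E.
Proof.
move=> r0 ry m m0; rewrite leNgt; apply/negP => /exists_real_between[t rt tm].
have t0 : 0 <= t by apply: le_trans (ltW rt); rewrite exprn_ge0.
have [i i0 Ai] := A_irr y x; have [j j0 Aj] := A_irr x y.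
have [eta eta0 etaA] := gt0_real_lower_bound (mule_gt0 Ai Aj).
have [Q _ HQ] :=
  geometric_domination (r ^+ (i + j)) (exprn_ge0 m r0) rt eta0.
have := HQ Q.+1 (leqnSn Q); apply/negP; rewrite -leNgt -lee_fin.
have -> : r ^+ (i + j) * (r ^+ m) ^+ Q.+1 = r ^+ (i + Q.+1 * m + j).
  by rewrite -exprM -exprD mulnC addnAC.
have n0 : (0 < i + Q.+1 * m + j)%N by rewrite -addnA ltn_addr.
apply: le_trans (ry _ n0).
apply: le_trans (mpowD_ge _ j y y x A_ge0).
apply: (@le_trans _ _ (mpow A i y x * mpow A (Q.+1 * m) x x * mpow A j x y)%E);
  last by rewrite lee_wpmul2r ?mpow_ge0// mpowD_ge.
rewrite muleAC EFinM lee_pmul ?lee_fin ?exprn_ge0 ?(ltW eta0)//.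
exact: (supermul_expr_le (@diag_supermul x)).
Qed.

Lemma root_sup_diag_eq x y : root_sup (diag x) = root_sup (diag y).
Proof.
suff le_root u v : (root_sup (diag u) <= root_sup (diag v))%E.
  by apply/eqP; rewrite eq_le !le_root.
have := root_sup_ge0 (diag v).
have := fun r => @root_sup_leP _ _ (@diag_ge0 v) r.
case: (root_sup (diag v)) => [r| |] // leP; rewrite ?leey// lee_fin => r0.
apply/(root_sup_leP (@diag_ge0 u) r0).
exact: (@diag_bound_transfer r u v r0 ((leP r r0).1 (lexx _))).
Qed.

Lemma spectral_radius_root_sup x : spectral_radius A = root_sup (diag x).
Proof.
apply: get_unique => [y|r Ar].
  by rewrite (root_sup_diag_eq x y); exact: (cvg_root_sup (@diag_ge0 y) (@diag_supermul y)).
have pF := within_support_proper x.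
exact: (cvg_unique (@ereal_hausdorff R) (Ar x)
  (cvg_root_sup (@diag_ge0 x) (@diag_supermul x))).
Qed.

(** The spectral radius is the least [r] with [A^n(x,x) <= r^n] for all [n]. All
    that follows uses it only through this characterization. *)
Lemma spectral_radius_leP x (r : R) : 0 <= r ->
  (spectral_radius A <= r%:E)%E <->
  forall n, (0 < n)%N -> (mpow A n x x <= (r ^+ n)%:E)%E.
Proof.
by move=> r0; rewrite (spectral_radius_root_sup x); exact: root_sup_leP.
Qed.

Lemma spectral_radius_real (x : S) : (spectral_radius A < +oo)%E ->
  exists2 r : R, 0 < r & spectral_radius A = r%:E.
Proof.
have := root_sup_ge0 (diag x); have := @spectral_radius_leP x.
rewrite -(spectral_radius_root_sup x).
case: (spectral_radius A) => [r| |] // leP; rewrite lee_fin => r0 _.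
exists r => //; rewrite lt0r r0 andbT; apply/eqP => r_eq0.
have [n n0 An] := A_irr x x.
have /(_ n n0) := (leP r r0).1 (lexx _).
by rewrite r_eq0 expr0n gtn_eqF// leNgt An.
Qed.

End SpectralRadius.

Lemma le_spectral_radius (R : realType) (S : countType)
    (A B : S -> S -> R) (x : S) :
  nonneg_matrix A -> (forall x y, A x y <= B x y) -> irreducible_matrix A ->
  (spectral_radius A <= spectral_radius B)%E.
Proof.
move=> A0 AB Ai; have Bi := le_irreducible A0 AB Ai.
have B0 : nonneg_matrix B by move=> u v; exact: le_trans (AB u v).
have [rB|] := ltP (spectral_radius B) +oo%E; last first.
  by rewrite leye_eq => /eqP->; rewrite leey.
have [r r0 rE] := spectral_radius_real B0 Bi x rB; rewrite rE.
apply/(spectral_radius_leP A0 Ai x (ltW r0)) => n n0.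
apply: le_trans (le_mpow n x x A0 AB) _.
by apply: ((spectral_radius_leP B0 Bi x (ltW r0)).1 _ n n0); rewrite rE.
Qed.

(** * The Green function *)

Section GreenFunction.
Context {R : realType} {S : countType}.
Variables (A : S -> S -> R) (r : R).
Hypotheses (A_ge0 : nonneg_matrix A) (r_gt0 : 0 < r).
Local Open Scope ereal_scope.

Definition green x y : \bar R := \sum_(n <oo) ((r ^- n)%:E * mpow A n x y).

Let term_ge0 n x y : 0 <= (r ^- n)%:E * mpow A n x y.
Proof.
by rewrite mule_ge0 ?mpow_ge0// lee_fin invr_ge0 exprn_ge0// ltW.
Qed.

Lemma green_ge0 x y : 0 <= green x y.
Proof. by apply: nneseries_ge0 => n _ _. Qed.

Lemma green_diag_ge1 x : 1 <= green x x.
Proof.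
apply: (le_trans _ (nneseries_ge_term 0 (fun n => term_ge0 n x x))).
by rewrite /= eqxx mule1 expr0 invr1.
Qed.

(** The powers in [A green] start at [A^1], those in [green] at [A^0]: the point
    mass at [y] that makes the difference is the slack that a perturbation of [A]
    in row [y] can use. *)
Lemma green_supersolution x y :
  \esum_(z in [set: S]) ((A x z)%:E * green z y) + r%:E * (x == y)%:R%:E
  <= r%:E * green x y.
Proof.
rewrite /green (@nneseries_recl _ xpredT)// expr0 invr1 mul1e/=.
rewrite ge0_muleDr ?lee_fin ?ler0n//; last first.
  by apply: nneseries_ge0 => n _ _.
rewrite addeC leeD2l//.
under eq_esum do rewrite -nneseriesZl//.
apply: le_trans.
  by apply: esum_nneseries_le => z n; rewrite mule_ge0 ?lee_fin.
rewrite -(nneseries_addn (f := fun n => (r ^- n)%:E * mpow A n x y) 1)//.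
rewrite -nneseriesZl//; apply: lee_nneseries => [n _ _|n _].
  by apply: esum_ge0 => z _; rewrite mule_ge0 ?lee_fin.
under eq_esum do rewrite muleCA.
rewrite ge0_esumZl ?lee_fin ?invr_ge0 ?exprn_ge0 ?(ltW r_gt0)//; last first.
  by move=> z; rewrite mule_ge0 ?lee_fin ?mpow_ge0.
rewrite addn1 muleA -EFinM exprS invfM mulrA mulfV ?gt_eqF// mul1r.
by rewrite lexx.
Qed.

(** By irreducibility all entries of [green] are comparable up to a positive
    factor, so that they are all finite or all infinite. *)
Lemma green_pinfty_transfer x y x' y' : irreducible_matrix A -> green x y = +oo ->
  \sum_(1 <= n <oo) ((r ^- n)%:E * mpow A n x' y') = +oo.
Proof.
move=> A_irr Gxy; have [i i0 Ai] := A_irr x' x; have [j j0 Aj] := A_irr y y'.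
have [eta eta0 etaA] := gt0_real_lower_bound (mule_gt0 Ai Aj).
pose c := (r ^- (i + j) * eta)%R.
have c0 : (0 < c)%R by rewrite mulr_gt0// invr_gt0 exprn_gt0.
apply/eqP; rewrite -leye_eq.
have <- : c%:E * green x y = +oo by rewrite Gxy gt0_muley.
rewrite /green -nneseriesZl//.
apply: (@le_trans _ _ (\sum_(n <oo)
    ((r ^- (n + (i + j)))%:E * mpow A (n + (i + j)) x' y'))).
  apply: lee_nneseries => [n _ _|n _].
    by rewrite mule_ge0 ?lee_fin ?(ltW c0).
  have -> : c%:E * ((r ^- n)%:E * mpow A n x y) =
      (r ^- (n + (i + j)))%:E * (eta%:E * mpow A n x y).
    by rewrite !muleA -!EFinM exprD invfM /c; congr (_%:E * _); ring.
  rewrite lee_wpmul2l ?lee_fin ?invr_ge0 ?exprn_ge0 ?(ltW r_gt0)//.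
  apply: (@le_trans _ _ (mpow A i x' x * mpow A n x y * mpow A j y y')).
    by rewrite muleAC lee_wpmul2r ?mpow_ge0.
  have -> : (n + (i + j) = i + n + j)%N by rewrite addnCA addnA.
  apply: le_trans (mpowD_ge _ j x' y' y A_ge0).
  by rewrite lee_wpmul2r ?mpow_ge0// mpowD_ge.
rewrite (nneseries_addn (f := fun n => (r ^- n)%:E * mpow A n x' y') (i + j))//.
rewrite [leRHS](@nneseries_split _ _ 1 (i + j).-1)// add1n prednK ?addn_gt0 ?i0//.
by rewrite leeDr// sume_ge0.
Qed.

Lemma green_pinfty_of_tail x y :
  \sum_(1 <= n <oo) ((r ^- n)%:E * mpow A n x y) = +oo -> green x y = +oo.
Proof.
move=> sumy; apply/eqP; rewrite -leye_eq -sumy.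
by rewrite /green (@nneseries_recl _ xpredT)// leeDr.
Qed.

End GreenFunction.

(** * Finite perturbations of matrices with a finite Green function *)

Section FinitePerturbation.
Context {R : realType} {S : countType}.
Variables (A D : S -> S -> R) (r : R).
Hypotheses (A_ge0 : nonneg_matrix A) (D_ge0 : nonneg_matrix D) (r_gt0 : 0 < r).
Hypothesis green_fin : forall x y, (green A r x y < +oo)%E.
Variable s : seq (S * S).
Hypothesis D_supp : forall x y, D x y != 0 -> (x, y) \in s.
Local Open Scope ereal_scope.

Let P := map fst s.

Let h x : \bar R := \sum_(p <- P) green A r x p.

Let h_ge0 x : 0 <= h x.
Proof. by apply: sume_ge0 => p _; exact: green_ge0. Qed.

Let h_fin x : h x < +oo.
Proof.
rewrite /h; elim: P => [|p p' IH]; first by rewrite big_nil.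
by rewrite big_cons lte_add_pinfty.
Qed.

Let h_slack x :
  \esum_(z in [set: S]) ((A x z)%:E * h z) + r%:E * (x \in P)%:R%:E
  <= r%:E * h x.
Proof.
apply: (@le_trans _ _ (\sum_(p <- P) (\esum_(z in [set: S])
   ((A x z)%:E * green A r z p) + r%:E * (x == p)%:R%:E))); last first.
  rewrite /h ge0_sume_distrr; last by move=> p _; exact: green_ge0.
  by apply: lee_sum => p _; exact: green_supersolution.
rewrite big_split/= leeD//.
  rewrite -esum_sum; last by move=> z p _ _; rewrite mule_ge0 ?lee_fin ?green_ge0.
  apply: le_esum => z _; rewrite /h ge0_sume_distrr// => p _; exact: green_ge0.
have [xP|_] := boolP (x \in P); last first.
  rewrite mule0 sume_ge0// => p _.
  by rewrite -EFinM lee_fin mulr_ge0 ?ler0n ?(ltW r_gt0).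
rewrite (big_rem x)//= eqxx leeDl// sume_ge0// => p _.
by rewrite -EFinM lee_fin mulr_ge0 ?ler0n ?(ltW r_gt0).
Qed.

Let load x : \bar R := \esum_(z in [set: S]) ((D x z)%:E * h z).

Let load_ge0 x : 0 <= load x.
Proof. by apply: esum_ge0 => z _; rewrite mule_ge0 ?lee_fin. Qed.

Let load_out x : x \notin P -> load x = 0.
Proof.
move=> xP; apply: esum1 => z _.
have [->|Dxz] := eqVneq (D x z) 0%R; first by rewrite mul0e.
by case/negP: xP; apply/mapP; exists (x, z); rewrite ?D_supp.
Qed.

Let load_fin x : load x < +oo.
Proof.
apply: (@le_lt_trans _ _ (\esum_(z in [set: S]) \sum_(q <- map snd s)
    ((z == q)%:R%:E * ((D x z)%:E * h z)))).
  apply: le_esum => z _.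
  have term0 q : 0 <= (z == q)%:R%:E * ((D x z)%:E * h z).
    by rewrite !mule_ge0 ?lee_fin.
  have [->|Dxz] := eqVneq (D x z) 0%R.
    by rewrite mul0e sume_ge0// => q _; rewrite mule0.
  rewrite (big_rem z)/=; last by apply/mapP; exists (x, z); rewrite ?D_supp.
  by rewrite eqxx mul1e leeDl// sume_ge0.
rewrite esum_sum; last by move=> z q _ _; rewrite !mule_ge0 ?lee_fin.
elim: (map snd s) => [|q t IH]; first by rewrite big_nil.
rewrite big_cons lte_add_pinfty//.
apply: (@le_lt_trans _ _ ((D x q)%:E * h q)); last first.
  by rewrite lte_mul_pinfty ?lee_fin.
rewrite -[leRHS](@esum_set1 _ _ q (fun z => (D x z)%:E * h z)); last first.
  by rewrite mule_ge0 ?lee_fin.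
rewrite [leRHS]esum_mkcond; apply: le_esum => z _.
have [->|_] := eqVneq z q; first by rewrite mem_set// mul1e.
by rewrite mul0e; case: ifPn => // _; rewrite mule_ge0 ?lee_fin.
Qed.

(** The slack [r 1_P] left by [h] as a supersolution for [A] absorbs [eps D h],
    since [D h], here [load], is finite and vanishes outside [P]. Hence [h] is also
    a supersolution for [A + eps D]. *)
Lemma finite_perturbation_mpow_le : s != [::] ->
  exists2 eps : R, (0 < eps)%R & exists x, forall n,
    mpow (fun x y => A x y + eps * D x y)%R n x x <= (r ^+ n)%:E.
Proof.
move=> s0.
pose M := \sum_(p <- P) load p.
have M_fin : M < +oo.
  rewrite /M; elim: P => [|p p' IH]; first by rewrite big_nil.
  by rewrite big_cons lte_add_pinfty.
have M0 : 0 <= M by apply: sume_ge0 => p _.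
have ME : M = (fine M)%:E by rewrite fineK// ge0_fin_numE.
have fM0 : (0 <= fine M)%R by exact: fine_ge0.
(* Dividing by [fine M + 1] covers the case [M = 0]. *)
pose eps := (r / (fine M + 1))%R.
have eps0 : (0 < eps)%R by rewrite divr_gt0// ltr_wpDl.
exists eps => //.
have [x xP] : exists x, x \in P.
  by case: s s0 @P => // p t _; exists p.1; rewrite inE eqxx.
exists x => n.
have eps_load y : eps%:E * load y <= r%:E * (y \in P)%:R%:E.
  have [yP|yP] := boolP (y \in P); last by rewrite load_out// !mule0.
  rewrite mule1; apply: (@le_trans _ _ (eps%:E * M)).
    rewrite lee_wpmul2l ?lee_fin ?(ltW eps0)//.
    by rewrite /M (big_rem y)//= leeDl// sume_ge0.
  rewrite ME -EFinM lee_fin /eps mulrAC ler_pdivrMr ?ltr_wpDl//.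
  by rewrite ler_wpM2l ?(ltW r_gt0)// lerDl.
have C0 : nonneg_matrix (fun x y => A x y + eps * D x y)%R.
  by move=> u v; rewrite addr_ge0// mulr_ge0// ltW.
have hx_gt0 : 0 < h x.
  apply: lt_le_trans (lte01) _; apply: le_trans (green_diag_ge1 A_ge0 r_gt0 x) _.
  by rewrite /h (big_rem x)//= leeDl// sume_ge0// => p _; exact: green_ge0.
have hxE : h x = (fine (h x))%:E by rewrite fineK// ge0_fin_numE.
have Ch y : \esum_(z in [set: S]) ((A y z + eps * D y z)%:E * h z) <=
    r%:E * h y.
  apply: le_trans (h_slack y).
  apply: (@le_trans _ _
    (\esum_(z in [set: S]) ((A y z)%:E * h z) + eps%:E * load y)); last first.
    by rewrite leeD2l.
  rewrite /load -ge0_esumZl ?lee_fin ?(ltW eps0)//; last first.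
    by move=> z; rewrite mule_ge0 ?lee_fin.
  rewrite -esumD; last 2 first.
  - by move=> z _; rewrite mule_ge0 ?lee_fin.
  - by move=> z _; rewrite !mule_ge0 ?lee_fin ?(ltW eps0).
  apply: le_esum => z _; rewrite EFinD ge0_muleDl ?lee_fin//; last first.
    by rewrite mulr_ge0 ?(ltW eps0).
  by rewrite EFinM muleA.
have := supersolution_mpow_le C0 (ltW r_gt0) h_ge0 Ch n x x.
by rewrite hxE lee_pmul2r// -hxE.
Qed.

End FinitePerturbation.

(** * Matrices below a strictly larger one of the same growth *)

Section Renewal.
Context {R : realType}.

(** The partial sums [V M] of [v] satisfy [V (M + N) >= W * V M] with
    [W = \sum_(j < N) w j], while [V (M + N) - V M <= N] because [v <= 1]. If [W > 1]
    the first bound makes [V] unbounded and the two together bound it. *)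
Lemma renewal_sum_le1 (v w : nat -> R) :
  (forall n, 0 <= v n) -> (forall n, 0 <= w n) -> (forall n, v n <= 1) ->
  v 0 = 1 ->
  (forall m, \sum_(j < m) w j * v (m.-1 - j)%N <= v m) ->
  forall N, \sum_(j < N) w j <= 1.
Proof.
move=> v0 w0 v1 v00 vw N.
pose V M := \sum_(m < M) v m.
have V0 M : 0 <= V M by apply: sumr_ge0.
have VS M : V M.+1 = V M + v M by rewrite /V big_ord_recr.
(* The renewal inequality summed over time; the boundary terms vanish because
   [V 0 = 0]. *)
have Vconv M : \sum_(j < M) w j * V (M.-1 - j)%N <= V M.
  elim: M => [|M IH]; first by rewrite /V !big_ord0.
  rewrite big_ord_recr/= subnn {2}/V big_ord0 mulr0 addr0 VS.
  apply: le_trans (lerD IH (vw M)).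
  rewrite -big_split/=; apply: ler_sum => -[j jM] _ /=.
  have -> : (M - j = (M.-1 - j).+1)%N by lia.
  by rewrite VS mulrDr.
have Vmono M N' : V M <= V (M + N')%N.
  by elim: N' => [|N' IH]; rewrite ?addn0// addnS VS (le_trans IH)// lerDl.
have Vstep M : V (M + N)%N <= V M + N%:R.
  elim: N => [|k IH]; first by rewrite !addr0 addn0.
  by rewrite addnS VS -natr1 addrA lerD.
rewrite leNgt; apply/negP => W1; set W := \sum_(j < N) w j in W1.
have Vmul M : W * V M <= V (M + N)%N.
  apply: le_trans (Vconv _); rewrite addnC big_split_ord/= mulr_suml.
  rewrite ler_wpDr//; first by apply: sumr_ge0 => j _; rewrite mulr_ge0.
  apply: ler_sum => -[j jN] _ /=; rewrite ler_wpM2l//.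
  have -> : ((N + M).-1 - j = M + (N.-1 - j))%N by lia.
  exact: Vmono.
have V_bounded M : V M * (W - 1) <= N%:R.
  by have := le_trans (Vmul M) (Vstep M); nra.
have V_unbounded k : k%:R * (W - 1) <= V (1 + k * N)%N.
  elim: k => [|k IH]; first by rewrite mul0r.
  rewrite mulSn addnCA addnC; apply: le_trans (Vmul _).
  have V1 : 1 <= V (1 + k * N)%N.
    by apply: le_trans (Vmono 1%N _); rewrite /V big_ord1 v00.
  rewrite -natr1; nra.
have W0 : 0 < (W - 1) ^+ 2 by rewrite exprn_gt0// subr_gt0.
have [k Hk] : exists k : nat, N%:R / (W - 1) ^+ 2 < k%:R.
  exists (Num.bound (N%:R / (W - 1) ^+ 2)).
  by rewrite archi_boundP// divr_ge0// ltW.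
move: Hk; rewrite ltr_pdivrMr// ltNge => /negP; apply.
apply: le_trans (V_bounded (1 + k * N)%N).
by rewrite expr2 mulrA ler_wpM2r// subr_ge0 ltW.
Qed.

End Renewal.

Section StrictlyLarger.
Context {R : realType} {S : countType}.
Variables (A B : S -> S -> R) (x0 y0 : S) (d : R).
Hypotheses (A_ge0 : nonneg_matrix A) (d_ge0 : 0 <= d).
Hypothesis leAB : forall x y, A x y <= B x y.
Hypothesis leAdB : A x0 y0 + d <= B x0 y0.

Let B_ge0 : nonneg_matrix B.
Proof. by move=> x y; exact: le_trans (leAB x y). Qed.

(** A path that uses the increment [d] at [(x0, y0)] follows [A] for [j] steps, makes
    the jump for the first time and then follows [B]: different [j] correspond to
    disjoint parts of [B^m]. *)
Lemma mpow_first_use_ge m x y :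
  (\sum_(j < m) (d%:E * mpow A j x x0 * mpow B (m.-1 - j) y0 y)
    <= mpow B m x y)%E.
Proof.
elim: m x => [|m IH] x; first by rewrite big_ord0 mpow_ge0.
rewrite big_ord_recl /= subn0.
apply: (@le_trans _ _ (\esum_(z in [set: S])
   ((if z == y0 then d%:E * (x == x0)%:R%:E * mpow B m y0 y else 0) +
    (A x z)%:E * mpow B m z y))%E); last first.
  apply: le_esum => z _; have [->|_] := eqVneq z y0; last first.
    by rewrite add0e lee_wpmul2r ?mpow_ge0 ?lee_fin.
  rewrite -EFinM -ge0_muleDl ?lee_fin ?mulr_ge0 ?ler0n//.
  rewrite -EFinD lee_wpmul2r ?mpow_ge0 ?lee_fin//.
  have [->|_] := eqVneq x x0; first by rewrite mulr1 addrC.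
  by rewrite mulr0 add0r.
rewrite esumD; last 2 first.
- by move=> z _; case: ifP => // _; rewrite !mule_ge0 ?lee_fin ?mpow_ge0.
- by move=> z _; rewrite !mule_ge0 ?lee_fin ?mpow_ge0.
apply: leeD.
  by apply: le_trans (esum_ge_term _ y0); rewrite eqxx.
apply: (@le_trans _ _ (\esum_(z in [set: S]) \sum_(j < m)
   ((A x z)%:E * (d%:E * mpow A j z x0 * mpow B (m.-1 - j) y0 y)))%E); last first.
  apply: le_esum => z _; rewrite -ge0_sume_distrr; last first.
    by move=> j _; rewrite !mule_ge0 ?lee_fin ?mpow_ge0.
  by rewrite lee_wpmul2l ?lee_fin.
rewrite esum_sum; last first.
  by move=> z j _ _; rewrite !mule_ge0 ?lee_fin ?mpow_ge0.
apply: lee_sum => -[j jm] _ /=.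
have -> : (m - bump 0 j = m.-1 - j)%N by rewrite /bump; lia.
rewrite -ge0_esumZl ?lee_fin//; last first.
  by move=> z; rewrite mule_ge0 ?lee_fin ?mpow_ge0.
rewrite -ge0_esumZr ?mpow_ge0//; last first.
  by move=> z; rewrite !mule_ge0 ?lee_fin ?mpow_ge0.
by apply: le_esum => z _; rewrite !muleA [(d%:E * _)%E]muleC.
Qed.

(** With [r] bounding the growth of [B], the numbers [r^-m B^m(y0,y0)] form a
    renewal-type sequence bounded by [1] with weights
    [d r^-(j+1) A^j(y0,x0)], whose sum is therefore at most [1]. *)
Lemma green_lt_pinfty_of_bound (r : R) : 0 < r -> 0 < d ->
  (forall n, (mpow B n y0 y0 <= (r ^+ n)%:E)%E) ->
  (green A r y0 x0 < +oo)%E.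
Proof.
move=> r0 d0 Br.
pose b m := fine (mpow B m y0 y0).
have bE m : mpow B m y0 y0 = (b m)%:E.
  by rewrite fineK// ge0_fin_numE ?mpow_ge0// (le_lt_trans (Br m)) ?ltry.
have b0 m : 0 <= b m by rewrite fine_ge0 ?mpow_ge0.
pose a j := fine (mpow A j y0 x0).
(* Going from [y0] to [x0] with [A] and back with the increment is part of a loop
   of [B], which has finite weight. *)
have aE j : mpow A j y0 x0 = (a j)%:E.
  rewrite fineK// ge0_fin_numE ?mpow_ge0// ltey; apply/eqP => Aj.
  have := mpow_first_use_ge j.+1 y0 y0; rewrite big_ord_recr/= subnn Aj.
  rewrite /= eqxx mule1 gt0_muley ?lte_fin// addey; last first.
    rewrite -ltNye; apply: lt_le_trans ltNy0 _; apply: sume_ge0 => i _.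
    by rewrite !mule_ge0 ?lee_fin ?mpow_ge0.
  by rewrite -[X in (_ <= X)%E]/(mpow B j.+1 y0 y0) bE.
have a0 j : 0 <= a j by rewrite fine_ge0 ?mpow_ge0.
have rX0 m : 0 < r ^- m by rewrite invr_gt0 exprn_gt0.
have sum_le1 N : \sum_(j < N) d / r * (r ^- j * a j) <= 1.
  apply: (renewal_sum_le1 (v := fun m => r ^- m * b m)
                          (w := fun j => d / r * (r ^- j * a j))).
  - by move=> n /=; rewrite mulr_ge0// ltW.
  - move=> n /=; rewrite mulr_ge0 ?divr_ge0 ?(ltW r0)//.
    by rewrite mulr_ge0 ?(ltW (rX0 n)).
  - move=> n /=; rewrite mulrC ler_pdivrMr ?exprn_gt0// mul1r -lee_fin -bE.
    exact: Br.
  - by rewrite /= expr0 invr1 mul1r /b /= eqxx.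
  move=> m /=.
  have b_ge : \sum_(j < m) d * a j * b (m.-1 - j)%N <= b m.
    rewrite -lee_fin -bE -sumEFin; apply: le_trans (mpow_first_use_ge m y0 y0).
    by apply: lee_sum => j _; rewrite aE bE -!EFinM.
  apply: le_trans (ler_wpM2l (ltW (rX0 m)) b_ge).
  rewrite mulr_sumr; apply: ler_sum => -[j jm] _ /=.
  have -> : r ^- m = r ^- j * r^-1 * r ^- (m.-1 - j).
    by rewrite -!invfM -exprSr -exprD; congr (r ^- _); lia.
  by rewrite le_eqVlt; apply/orP; left; apply/eqP; ring.
apply: (@le_lt_trans _ _ (r / d)%:E); last exact: ltry.
apply: lime_le.
  by apply: is_cvg_nneseries => n _ _; rewrite mule_ge0 ?mpow_ge0// lee_fin ltW.
apply: nearW => N; rewrite big_mkord.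
under eq_bigr do rewrite aE -EFinM.
rewrite sumEFin lee_fin; have := sum_le1 N.
by rewrite -mulr_sumr -ler_pdivlMl ?divr_gt0// invf_div mulr1.
Qed.

End StrictlyLarger.

Lemma transient_green_fin (R : realType) (S : countType) (A : S -> S -> R)
    (r : R) (x y : S) :
  nonneg_matrix A -> irreducible_matrix A -> 0 < r ->
  spectral_radius A = r%:E -> R_transient A -> (green A r x y < +oo)%E.
Proof.
move=> A0 Ai r0 rE At; rewrite ltey; apply/eqP => Gxy; apply: At.
rewrite /R_recurrent rE ltry; split => //; exists x.
exact: (green_pinfty_transfer A0 r0 _ _ Ai Gxy).
Qed.

(** * Comparison of spectral radii *)

Theorem theorem5 (R : realType) (S : countType) (A B : S -> S -> R)
    (A_ge0 : nonneg_matrix A) (B_ge0 : nonneg_matrix B)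
    (A_irr : irreducible_matrix A) (B_irr : irreducible_matrix B)
    (leAB : forall x y, A x y <= B x y)
    (neqBA : B <> A)
    (rhoB_fin : (spectral_radius B < +oo)%E) :
  (R_transient A ->
   finite_set [set p : S * S | A p.1 p.2 <> B p.1 p.2] ->
   exists2 eps : R, 0 < eps &
     spectral_radius (fun x y => A x y + eps * (B x y - A x y))
       = spectral_radius A) /\
  (spectral_radius B = spectral_radius A -> R_transient A).
Proof.
have [x0 [y0 AB0]] : exists x0 y0, A x0 y0 < B x0 y0.
  apply: contrapT => AB; apply: neqBA; apply/funext => x; apply/funext => y.
  apply/eqP; rewrite eq_le leAB andbT leNgt; apply/negP => ABxy.
  by apply: AB; exists x, y.
have leAB_rho := le_spectral_radius x0 A_ge0 leAB A_irr.
have [r r0 rE] :=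
  spectral_radius_real A_ge0 A_irr x0 (le_lt_trans leAB_rho rhoB_fin).
split=> [A_trans /finite_seqP[s sE]|rhoBA [_ [x Arec]]].
- have D_ge0 : nonneg_matrix (fun x y => B x y - A x y).
    by move=> x y; rewrite subr_ge0.
  have D_supp x y : B x y - A x y != 0 -> (x, y) \in s.
    move=> Dxy; have : [set` s] (x, y); last by [].
    by rewrite -sE /= => AB; rewrite AB subrr eqxx in Dxy.
  have s0 : s != [::].
    apply/eqP => s_nil; have := D_supp x0 y0.
    by rewrite s_nil subr_eq0 gt_eqF// => /(_ isT).
  have G_fin x y := transient_green_fin x y A_ge0 A_irr r0 rE A_trans.
  have [eps eps0 [x Cx]] :=
    finite_perturbation_mpow_le A_ge0 D_ge0 r0 G_fin D_supp s0.
  have leAC u v : A u v <= A u v + eps * (B u v - A u v).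
    by rewrite lerDl mulr_ge0 ?subr_ge0 ?(ltW eps0).
  exists eps => //; apply/eqP; rewrite eq_le; apply/andP; split; last first.
    exact: (le_spectral_radius x).
  rewrite rE; apply/(spectral_radius_leP _ _ x (ltW r0)) => //.
    by move=> u v; exact: le_trans (leAC u v).
  exact: le_irreducible A_irr.
have Bx n : (mpow B n y0 y0 <= (r ^+ n)%:E)%E.
  case: n => [|n]; first by rewrite expr0 /= eqxx.
  apply: ((spectral_radius_leP B_ge0 B_irr y0 (ltW r0)).1 _ n.+1) => //.
  by rewrite rhoBA rE.
have d0 : 0 < B x0 y0 - A x0 y0 by rewrite subr_gt0.
have leAdB : A x0 y0 + (B x0 y0 - A x0 y0) <= B x0 y0 by rewrite addrC subrK.
have := green_lt_pinfty_of_bound A_ge0 (ltW d0) leAB leAdB r0 d0 Bx.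
move: Arec; rewrite rE /= => /(green_pinfty_of_tail A_ge0 r0) Gxx.
have tail := green_pinfty_transfer A_ge0 r0 y0 x0 A_irr Gxx.
by rewrite (green_pinfty_of_tail A_ge0 r0 tail).
Qed.
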